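(* Let $f\ge2$ be an integer, $l$ an odd prime with $l\equiv1\pmod f$, $l=ef+1$, and $d\in(\mathbb{Z}/l\mathbb{Z})^\times$. Let $K$ be a field with $\operatorname{char}K\nmid f$, $\operatorname{char}K\ne l$, and $\operatorname{Gal}(K(\zeta_l)/K)\simeq(\mathbb{Z}/l\mathbb{Z})^\times=\langle\gamma\rangle$. Put $\beta=\gamma^e$ and let $M$ be the fixed field in $K(\zeta_l)$ of the subgroup generated by $\zeta_l\mapsto\zeta_l^\beta$. For ${\bf p}_1,{\bf p}_2\in K^\times$ let $\alpha_{{\bf p}_1}=\sum_{i=0}^{l-1}a_i\zeta_l^i$ and $\alpha_{{\bf p}_2}=\sum_{j=0}^{l-1}b_j\zeta_l^j$ ($a_i,b_j\in K$) with $N_{K(\zeta_l)/M}(\alpha_{{\bf p}_u})={\bf p}_u$, and let $\alpha_{{\bf p}_1{\bf p}_2,d}=(-1)^{f-1}\sigma_{-d}(\alpha_{{\bf p}_1})\alpha_{{\bf p}_2}$, where $\sigma_{-d}(\zeta_l)=\zeta_l^{-d}$. Then $\alpha_{{\bf p}_1{\bf p}_2,d}=\sum_{k=0}^{l-1}c_k\zeta_l^k$ with $c_k=(-1)^{f-1}\sum_{i=0}^{l-1}a_{-d^{-1}i}b_{k-i}$, and, with $$S_0=\sum_{i_0+\beta i_1+\cdots+\beta^{f-1}i_{f-1}\equiv0\ (l)}c_{i_0}\cdots c_{i_{f-1}},\qquad S_m=\sum_{i_0+\beta i_1+\cdots+\beta^{f-1}i_{f-1}\equiv\gamma^m\ (l)}c_{i_0}\cdots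 c_{i_{f-1}}\ (1\le m\le e)$$ (sums over $(\mathbb{Z}/l\mathbb{Z})^f$, indices mod $l$), one has (1) ${\bf p}_1{\bf p}_2=S_0-S_1$ and (2) $S_1=S_2=\cdots=S_e$. Moreover, if $a_0=b_0=0$, then $\alpha_{{\bf p}_1{\bf p}_2,d}=\sum_{k=1}^{l-1}c_k\zeta_l^k$ with $c_k=(-1)^{f-1}\big(\sum_{i=1}^{l-1}a_{-d^{-1}i}b_{k-i}-\sum_{i=1}^{l-1}a_{-d^{-1}i}b_{-i}\big)$, and these coefficients (with $c_0=0$) also satisfy (1) and (2).
   Context: $\zeta_l$ is a primitive $l$-th root of unity; $N_{K(\zeta_l)/M}$ is the field norm. *)

(* Defs.v *)
From mathcomp Require Import all_boot all_fingroup all_algebra all_solvable all_field.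

Set Implicit Arguments.
Unset Strict Implicit.
Unset Printing Implicit Defensive.

Import GRing.Theory.
Local Open Scope ring_scope.

Section CyclotomicAutomorphism.

Variables (K : fieldType) (L : splittingFieldType K) (zeta : L).

(* sigma_k, the automorphism zeta |-> zeta ^+ k of L over K; the default value
   1 only matters when there is no such automorphism, see cyclo_autE. *)
Definition cyclo_aut (k : nat) : gal_of {:L} :=
  odflt 1%g [pick s in 'Gal({:L} / 1)%g | s zeta == zeta ^+ k].

Lemma cyclo_autE (l k : nat) :
    prime l -> l.-primitive_root zeta -> <<1; zeta>>%VS = {:L}%VS ->
    ('Gal({:L} / 1) \isog units_Zp l)%g -> coprime k l ->
  cyclo_aut k zeta = zeta ^+ k.
Proof.
move=> pr_l zP genL isoG co_kl; rewrite /cyclo_aut.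
case: pickP => [s /andP[_ /eqP //] | no_s]; exfalso.
have l_gt0 := prime_gt0 pr_l.
have cardG : #|'Gal({:L} / 1)%g| = totient l.
  by rewrite (card_isog isoG) card_units_Zp.
have h_ex (s : gal_of {:L}) : {i : 'I_l | s zeta = zeta ^+ i}.
  by apply: (prim_rootP zP); rewrite -rmorphXn /= (prim_expr_order zP) rmorph1.
pose h s := sval (h_ex s).
have hE (s : gal_of {:L}) : s zeta = zeta ^+ h s by rewrite /h; case: (h_ex s).
have h_inj : {in 'Gal({:L} / 1)%g &, injective h}.
  move=> s t Gs Gt eq_h; apply/eqP/gal_eqP => a _.
  have /Fadjoin_polyP[p p1 ->] : a \in <<1; zeta>>%VS by rewrite genL memvf.
  rewrite -!horner_map /= !hE eq_h; congr _.[_].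
  apply/polyP=> i; rewrite !coef_map /=.
  have /vlineP[c ->] := polyOverP p1 i.
  by rewrite !linearZ /= !rmorph1.
have eq_h : [set h s | s in 'Gal({:L} / 1)%g] = [set i : 'I_l | coprime l i].
  apply/eqP; rewrite eqEcard card_in_imset // cardG; apply/andP; split.
    apply/subsetP=> _ /imsetP[s Gs ->]; rewrite inE coprime_sym.
    rewrite -(prim_root_exp_coprime _ zP) -hE.
    by rewrite fmorph_primitive_root.
  by rewrite totient_count_coprime big_mkord -sum1dep_card big_mkcond.
have lt_k : (k %% l < l)%N by rewrite ltn_pmod.
have: Ordinal lt_k \in [set h s | s in 'Gal({:L} / 1)%g].
  by rewrite eq_h inE /= coprime_modr coprime_sym.
case/imsetP=> s Gs eq_s; have := no_s s; rewrite Gs /= hE -eq_s /=.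
by rewrite (prim_expr_mod zP) eqxx.
Qed.

End CyclotomicAutomorphism.

Section Coefficients.

Variables (K : fieldType) (l : nat).
Implicit Types (a b c : 'Z_l -> K) (d beta r : 'Z_l).

Definition cyclo_elt (L : fieldExtType K) (zeta : L) c : L :=
  \sum_(k : 'Z_l) c k *: zeta ^+ k.

Definition comp_coef (f : nat) d a b (k : 'Z_l) : K :=
  (-1) ^+ f.-1 * \sum_(i : 'Z_l) a (- d^-1 * i) * b (k - i).

Definition comp_coef0 (f : nat) d a b (k : 'Z_l) : K :=
  if k == 0 then 0 else
  (-1) ^+ f.-1 * (\sum_(i : 'Z_l | i != 0) a (- d^-1 * i) * b (k - i)
                  - \sum_(i : 'Z_l | i != 0) a (- d^-1 * i) * b (- i)).

(* S_0 is residue_sum f beta c 0 and S_m is residue_sum f beta c (gamma ^+ m). *)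
Definition residue_sum (f : nat) beta c r : K :=
  \sum_(t : {ffun 'I_f -> 'Z_l} | \sum_(j < f) beta ^+ j * t j == r)
    \prod_(j < f) c (t j).

End Coefficients.

(* Main.v *)
Require Import Defs.
From mathcomp Require Import all_boot all_fingroup all_algebra all_solvable all_field.

Set Implicit Arguments.
Unset Strict Implicit.
Unset Printing Implicit Defensive.

Import GRing.Theory.
Local Open Scope ring_scope.

(* Expanding the product of the conjugates of [sum_k c_k zeta^k] over the group
   generated by [zeta |-> zeta^beta] gives [sum_r S(r) zeta^r], where [S(r)] is
   the residue sum of [c] at [r].  When this norm is a scalar [p], the tuple
   [S(r) - p * [r = 0]] is a K-linear relation between the powers of [zeta].
   Conjugating such a relation and applying Fourier inversion on Z/l shows that
   it is constant in [r].  As the Galois group is abelian, the norm of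
   [alpha12] is [p1 p2].  When [a_0 = 0], the second family of coefficients is
   [c_k - c_0], which represents the same element since the powers of [zeta]
   sum to 0. *)

(** * Powers of a root of unity with exponents in Z/l, and their orthogonality *)

Section RootsOfUnity.

Variables (R : idomainType) (l : nat) (zeta : R).
Hypotheses (l_gt1 : (1 < l)%N) (zP : l.-primitive_root zeta).
Implicit Types i j u : 'Z_l.

(* The casts keep the exponents' operations in Z/l; without them they would be
   read in nat. *)
Lemma prim_exprZpD i j : zeta ^+ (i + j : 'Z_l)%R = zeta ^+ i * zeta ^+ j.
Proof.
rewrite -exprD -(prim_expr_mod zP (i + j)).
by congr (_ ^+ (_ %% _)); apply: Zp_cast.
Qed.

Lemma prim_exprZpM i j : zeta ^+ (i * j : 'Z_l)%R = (zeta ^+ i) ^+ j.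
Proof.
rewrite -exprM -(prim_expr_mod zP (i * j)).
by congr (_ ^+ (_ %% _)); apply: Zp_cast.
Qed.

Lemma prim_exprZp_sum (I : Type) (s : seq I) (F : I -> 'Z_l) :
  zeta ^+ (\sum_(i <- s) F i : 'Z_l)%R = \prod_(i <- s) zeta ^+ F i.
Proof.
elim: s => [|x s IHs]; first by rewrite !big_nil.
by rewrite !big_cons prim_exprZpD IHs.
Qed.

Lemma prim_exprZp_inj : injective (fun i : 'Z_l => zeta ^+ i).
Proof.
move=> i j /eqP; rewrite (eq_prim_root_expr zP).
have lt_l (k : 'Z_l) : (k < l)%N by rewrite -[X in (_ < X)%N](Zp_cast l_gt1).
by rewrite !modn_small // => /eqP/val_inj.
Qed.

(** Translating the summation index by 1 multiplies the sum by [zeta ^+ u], which differs from 1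
    unless [u] is 0. *)
Lemma sum_prim_exprZp u :
  \sum_(k : 'Z_l) zeta ^+ (k * u : 'Z_l)%R = if u == 0 then l%:R else 0.
Proof.
case: eqVneq => [->|nz_u].
  under eq_bigr => k _ do rewrite mulr0 expr0.
  by rewrite sumr_const card_ord Zp_cast.
set S := \sum_k _.
have : (zeta ^+ u - 1) * S = 0.
  apply/eqP; rewrite mulrBl mul1r subr_eq0; apply/eqP.
  rewrite {2}/S (reindex_inj (addIr 1)) mulr_sumr; apply: eq_bigr => k _.
  by rewrite mulrDl mul1r prim_exprZpD mulrC.
move/eqP; rewrite mulf_eq0 subr_eq0 => /orP[|/eqP//].
rewrite -[1](expr0 zeta) => /eqP/(@prim_exprZp_inj u 0) u0.
by rewrite u0 eqxx in nz_u.
Qed.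

End RootsOfUnity.

(** * Galois action, norms and linear relations in the cyclotomic extension *)

Section CyclotomicExtension.

Variables (K : fieldType) (L : splittingFieldType K) (l : nat) (zeta : L).
Hypotheses (pr_l : prime l) (zP : l.-primitive_root zeta).
Hypothesis genL : <<1; zeta>>%VS = {:L}%VS.
Hypothesis isoG : ('Gal({:L} / 1) \isog units_Zp l)%g.
Implicit Types (u r : 'Z_l) (s t : gal_of {:L}) (c x : 'Z_l -> K).

Let l_gt1 : (1 < l)%N := prime_gt1 pr_l.

Lemma unit_prime_Zp u : (u \is a GRing.unit) = (u != 0).
Proof.
have lt_l : (u < l)%N by rewrite -[X in (_ < X)%N](Zp_cast l_gt1).
rewrite -{1}(natr_Zp u) unitZpE // prime_coprime // -val_eqE /= -lt0n.
case: posnP => [-> | u_gt0]; first by rewrite dvdn0.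
by rewrite gtnNdvd.
Qed.

Lemma gal_eq_zeta s t : s zeta = t zeta -> s = t.
Proof.
move=> eq_st; apply/eqP/gal_eqP => y _.
have /Fadjoin_polyP[p p1 ->] : y \in <<1; zeta>>%VS by rewrite genL memvf.
rewrite -!horner_map /= eq_st; congr _.[_].
apply/polyP=> i; rewrite !coef_map /=.
have /vlineP[k ->] := polyOverP p1 i.
by rewrite !linearZ /= !rmorph1.
Qed.

Lemma gal_commute s t : commute s t.
Proof.
have abG : abelian 'Gal({:L} / 1)%g.
  by rewrite (isog_abelian isoG) units_Zp_abelian.
have inG w : w \in 'Gal({:L} / 1)%g.
  by rewrite gal_kAut ?sub1v // kAutE k1HomE ahomWin subvf.
exact: (centsP abG).
Qed.

Lemma cyclo_aut_expr u : u != 0 -> cyclo_aut zeta u zeta = zeta ^+ u.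
Proof.
rewrite -unit_prime_Zp -{1}(natr_Zp u) unitZpE // coprime_sym.
exact: cyclo_autE.
Qed.

Lemma gal_cyclo_elt s u c :
    s zeta = zeta ^+ u ->
  s (cyclo_elt zeta c) = \sum_(k : 'Z_l) c k *: zeta ^+ (u * k : 'Z_l)%R.
Proof.
move=> s_z; rewrite linear_sum; apply: eq_bigr => k _.
by rewrite linearZ /= rmorphXn /= s_z (prim_exprZpM l_gt1 zP).
Qed.

Lemma cyclo_aut_iter u j :
  u != 0 -> (cyclo_aut zeta u ^+ j)%g zeta = zeta ^+ (u ^+ j : 'Z_l)%R.
Proof.
move=> nz_u; elim: j => [|j IHj].
  (* The exponent [u ^+ 0] is the unit of ['Z_l], whose underlying natural number reduces to 1. *)
  by rewrite expg0 gal_id -[RHS]/(zeta ^+ 1%N).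
rewrite expgSr galM ?memvf // IHj rmorphXn /= cyclo_aut_expr //.
by rewrite exprS (prim_exprZpM l_gt1 zP).
Qed.

(** An automorphism is determined by its value at [zeta], and distinct residues give distinct powers
    of [zeta]; so the [j]-th iterate is trivial exactly when [u ^+ j] is 1. *)
Lemma order_cyclo_aut u n :
    u != 0 -> (forall j, (u ^+ j == 1) = (n %| j)%N) ->
  #[cyclo_aut zeta u]%g = n.
Proof.
move=> nz_u ordP; set s := cyclo_aut zeta u.
have sP j : (#[s]%g %| j)%N = (n %| j)%N.
  rewrite order_dvdn -ordP; apply/eqP/eqP => [sj1 | uj1].
    apply: (prim_exprZp_inj l_gt1 zP); rewrite /= -cyclo_aut_iter // -/s sj1.
    by rewrite gal_id -[RHS]/(zeta ^+ 1%N).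
  apply: gal_eq_zeta; rewrite cyclo_aut_iter // uj1 gal_id.
  by rewrite -[LHS]/(zeta ^+ 1%N).
by apply/eqP; rewrite eqn_dvd sP dvdnn -sP dvdnn.
Qed.

(** By distributivity, each choice of one index [t j] per conjugate yields one monomial; grouping
    the choices by the exponent of [zeta] produces the residue sums. *)
Lemma cyclo_norm_expand u n c :
    u != 0 -> (forall j, (u ^+ j == 1) = (n %| j)%N) ->
  galNorm (fixedField <[cyclo_aut zeta u]>%g) {:L} (cyclo_elt zeta c)
    = cyclo_elt zeta (residue_sum n u c).
Proof.
move=> nz_u ordP; rewrite /galNorm gal_fixedField /=; set s := cyclo_aut zeta u.
have ord_s : #[s]%g = n by apply: order_cyclo_aut.
(* Listing the cyclic group by exponents below its order turns the norm into a product over ['I_n],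
   to which distributivity applies. *)
have -> : <[s]>%g = [set (s ^+ nat_of_ord j)%g | j : 'I_n].
  apply/setP=> t; apply/idP/imsetP => [/cyclePmin[j lt_j ->] | [j _ ->]].
    by rewrite ord_s in lt_j; exists (Ordinal lt_j).
  exact: mem_cycle.
rewrite big_imset /=; last first.
  move=> i j _ _ /eqP; rewrite eq_expg_mod_order ord_s !modn_small //.
  by move/eqP/val_inj.
under eq_bigr => j _ do rewrite (gal_cyclo_elt _ (cyclo_aut_iter j nz_u)).
rewrite bigA_distr_bigA /= /cyclo_elt /residue_sum.
pose v (t : {ffun 'I_n -> 'Z_l}) := \sum_(j < n) u ^+ j * t j.
rewrite (partition_big v predT) //=; apply: eq_bigr => r _.
rewrite scaler_suml; apply: eq_bigr => t /eqP <-.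
by rewrite scaler_prod (prim_exprZp_sum l_gt1 zP).
Qed.

Lemma sum_zeta : \sum_(k : 'Z_l) zeta ^+ k = 0.
Proof.
have := sum_prim_exprZp l_gt1 zP 1; rewrite oner_eq0.
by under eq_bigr => k _ do rewrite mulr1.
Qed.

(** For nonzero [u], [F u] is a conjugate of the given element, hence 0. Fourier inversion keeps
    only the term of [F 0], so [l] times [x q] does not depend on [q]. *)
Lemma cyclo_elt_eq0 x r : cyclo_elt zeta x = 0 -> x r = x 0.
Proof.
move=> x0; pose F u := \sum_(k : 'Z_l) x k *: zeta ^+ (u * k : 'Z_l)%R.
have F0 u : u != 0 -> F u = 0.
  by move=> nz_u; rewrite /F -(gal_cyclo_elt _ (cyclo_aut_expr nz_u)) x0 rmorph0.
have inv q : l%:R * (x q)%:A = F 0.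
  transitivity (\sum_u zeta ^+ (u * - q : 'Z_l)%R * F u); last first.
    rewrite (bigD1 0) // mul0r mul1r /= big1 ?addr0 // => u /F0->.
    by rewrite mulr0.
  have sumE k : \sum_u zeta ^+ (u * - q : 'Z_l)%R * (x k *: zeta ^+ (u * k : 'Z_l)%R)
                = x k *: (if k == q then l%:R else 0).
    rewrite -subr_eq0 -(sum_prim_exprZp l_gt1 zP) scaler_sumr.
    apply: eq_bigr => u _.
    by rewrite -scalerAr -(prim_exprZpD l_gt1 zP) -mulrDr addrC.
  rewrite /F; under eq_bigr => u _ do rewrite mulr_sumr.
  rewrite exchange_big; under eq_bigr => k _ do rewrite sumE.
  rewrite (bigD1 q) //= eqxx -scalerAr mulr1 big1 ?addr0 // => k /negPf->.
  by rewrite scaler0.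
(* The factor [l] cancels: it is nonzero in [L] because [L] contains a primitive [l]-th root of
   unity. *)
apply/(@fmorph_inj _ _ (in_alg L))/(mulfI (prim_root_natf_neq0 zP)).
by rewrite /= !inv.
Qed.

Lemma residue_sum_norm u n c (p : K) :
    u != 0 -> (forall j, (u ^+ j == 1) = (n %| j)%N) ->
    galNorm (fixedField <[cyclo_aut zeta u]>%g) {:L} (cyclo_elt zeta c) = p%:A ->
  forall r, r != 0 -> residue_sum n u c r = residue_sum n u c 0 - p.
Proof.
move=> nz_u ordP; rewrite (cyclo_norm_expand _ nz_u ordP).
set S := residue_sum n u c => normS r nz_r.
(* These are coefficients of the norm minus [p], that is, of 0. *)
pose x q := S q - (if q == 0 then p else 0).
suffices /(cyclo_elt_eq0 r) : cyclo_elt zeta x = 0.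
  by rewrite /x eqxx (negPf nz_r) subr0.
rewrite /cyclo_elt /x; under eq_bigr => q _ do rewrite scalerBl.
rewrite sumrB -/(cyclo_elt zeta S) normS (bigD1 0) //=.
by rewrite big1 ?addr0 ?subrr // => q /negPf->; rewrite scale0r.
Qed.

(** Since automorphisms commute, [s] passes through each factor of the norm. A norm lying in K is
    thus unchanged when [y] is replaced by [s y]. *)
Lemma galNorm_commute (V : {vspace L}) s (y : L) :
  galNorm V {:L} (s y) = s (galNorm V {:L} y).
Proof.
rewrite /galNorm rmorph_prod; apply: eq_bigr => t _ /=.
by rewrite -!galM ?memvf // gal_commute.
Qed.

(** Multiplication by [- d] permutes Z/l, and reindexing by its inverse puts [- d^-1] into the index
    of [a]; the product is then a cyclic convolution. *)
Lemma comp_coefE (f : nat) (d : 'Z_l) a b :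
    d != 0 ->
  (-1) ^+ f.-1 * cyclo_aut zeta (- d)%R (cyclo_elt zeta a) * cyclo_elt zeta b
    = cyclo_elt zeta (comp_coef f d a b).
Proof.
move=> nz_d; have Ud : d \is a GRing.unit by rewrite unit_prime_Zp.
have sE : cyclo_aut zeta (- d)%R zeta = zeta ^+ (- d : 'Z_l)%R.
  by apply: cyclo_aut_expr; rewrite oppr_eq0.
rewrite (gal_cyclo_elt _ sE) -mulrA.
have -> : \sum_(k : 'Z_l) a k *: zeta ^+ (- d * k : 'Z_l)%R
          = \sum_(i : 'Z_l) a (- d^-1 * i) *: zeta ^+ i.
  have UNd : - d^-1 \is a GRing.unit by rewrite unitrN unitrV.
  rewrite (reindex_inj (mulrI UNd)); apply: eq_bigr => i _.
  by rewrite mulrA mulrNN mulrV // mul1r.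
have -> (y : L) : (-1) ^+ f.-1 * y = (-1) ^+ f.-1 *: y.
  by rewrite -signr_odd mulr_sign -[in RHS]signr_odd scaler_sign.
rewrite /cyclo_elt /comp_coef; under [RHS]eq_bigr => k _ do rewrite -scalerA.
rewrite -scaler_sumr mulr_suml; congr (_ *: _).
under [RHS]eq_bigr => k _ do rewrite scaler_suml.
rewrite exchange_big; apply: eq_bigr => i _ /=.
rewrite mulr_sumr (reindex_inj (addIr (- i))); apply: eq_bigr => k _.
rewrite -scalerAl -scalerAr scalerA -(prim_exprZpD l_gt1 zP).
by rewrite (addrC i) subrK.
Qed.

(** The summand at [i = 0] contains the factor [a 0], so both sums may run over all of Z/l; the
    subtracted one is then the sum at [k = 0]. *)
Lemma comp_coef0E (f : nat) (d : 'Z_l) (a b : 'Z_l -> K) :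
    a 0 = 0 ->
  comp_coef0 f d a b =1 fun k => comp_coef f d a b k - comp_coef f d a b 0.
Proof.
move=> a0 k; rewrite /comp_coef0; case: eqP => [->|_]; first by rewrite subrr.
rewrite /comp_coef -mulrBr; congr (_ * (_ - _)).
  by rewrite [RHS](bigD1 0) //= mulr0 a0 mul0r add0r.
rewrite [RHS](bigD1 0) //= mulr0 a0 mul0r add0r.
by apply: eq_bigr => i _; rewrite sub0r.
Qed.

Lemma cyclo_elt_shift c (x0 : K) :
  cyclo_elt zeta (fun k => c k - x0) = cyclo_elt zeta c.
Proof.
rewrite /cyclo_elt; under eq_bigr => k _ do rewrite scalerBl.
by rewrite sumrB -scaler_sumr sum_zeta scaler0 subr0.
Qed.

End CyclotomicExtension.

Theorem theorem5p3 (f l e : nat) (K : fieldType) (L : splittingFieldType K)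
    (zeta : L) (gamma d : {unit 'Z_l}) (p1 p2 : K) (a b : 'Z_l -> K) :
  (2 <= f)%N -> prime l -> odd l -> l = 1 %[mod f] -> l = (e * f + 1)%N ->
  (forall p : nat, p \in [pchar K] -> ~~ (p %| f)%N) -> l \notin [pchar K] ->
  l.-primitive_root zeta -> <<1; zeta>>%VS = {:L}%VS ->
  ('Gal({:L} / 1) \isog units_Zp l)%g ->
  units_Zp l = <[gamma]>%g ->
  let g : 'Z_l := FinRing.uval gamma in
  let dl : 'Z_l := FinRing.uval d in
  let beta : 'Z_l := g ^+ e in
  let M : {vspace L} := fixedField <[cyclo_aut zeta beta]>%g in
  let alpha1 : L := cyclo_elt zeta a in
  let alpha2 : L := cyclo_elt zeta b in
  p1 != 0 -> p2 != 0 ->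
  galNorm M {:L} alpha1 = p1%:A -> galNorm M {:L} alpha2 = p2%:A ->
  let alpha12 : L := (-1) ^+ f.-1 * cyclo_aut zeta (- dl)%R alpha1 * alpha2 in
  let satisfies_1_2 (c : 'Z_l -> K) :=
    let S0 := residue_sum f beta c 0 in
    let S (m : nat) := residue_sum f beta c (g ^+ m) in
    p1 * p2 = S0 - S 1%N /\
    (forall m : nat, (1 <= m <= e)%N -> S m = S 1%N) in
  (let c := comp_coef f dl a b in
   alpha12 = \sum_(k : 'Z_l) c k *: zeta ^+ k /\ satisfies_1_2 c) /\
  (a 0 = 0 -> b 0 = 0 ->
   let c := comp_coef0 f dl a b in
   alpha12 = \sum_(k : 'Z_l | k != 0) c k *: zeta ^+ k /\ satisfies_1_2 c).
Proof.
move=> f_gt1 pr_l _ _ l_def _ _ zP genL isoG genU g dl beta M alpha1 alpha2.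
move=> _ _ norm1 norm2 alpha12 satisfies_1_2.
have l_gt1 := prime_gt1 pr_l.
have unit_neq0 (u : 'Z_l) : u \is a GRing.unit -> u != 0.
  by move=> Uu; apply: contraTneq Uu => ->; rewrite unitr0.
have Ug : g \is a GRing.unit := valP gamma.
have nz_g m : g ^+ m != 0 by rewrite unit_neq0 // unitrX.
have nz_dl : dl != 0 by apply/unit_neq0/(valP d).
have ef_gt0 : (0 < e * f)%N by move: (l_gt1); rewrite {1}l_def addn1 ltnS.
have ord_gamma : #[gamma]%g = (e * f)%N.
  rewrite orderE -genU card_units_Zp ?prime_gt0 // totient_prime // l_def.
  by rewrite addn1.
(* As [gamma] has order [e * f], the condition is that [e * f] divides [e * j], where [e] is
   positive and cancels. *)
have ord_beta j : (beta ^+ j == 1) = (f %| j)%N.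
  rewrite -exprM -FinRing.val_unitX -FinRing.val_unit1 val_eqE -order_dvdn.
  by rewrite ord_gamma dvdn_pmul2l //; case: (e) ef_gt0.
have ord_sigma := order_cyclo_aut pr_l zP genL isoG (nz_g e) ord_beta.
have normN1 : galNorm M {:L} (-1) = (-1) ^+ f.
  rewrite -[in RHS]ord_sigma /galNorm gal_fixedField -prodr_const.
  by apply: eq_bigr => s _; rewrite rmorphN1.
have norm12 : galNorm M {:L} alpha12 = (p1 * p2)%:A.
  rewrite !galNormM (galNorm_commute isoG) norm1 norm2.
  (* The sign disappears: its exponent [f * f.-1] is a product of consecutive integers, hence
     even. *)
  rewrite galNormX normN1 -exprM -signr_odd oddM.
  rewrite -subn1 oddB ?(ltnW f_gt1) // addbT andbN mul1r.
  by rewrite linearZ /= rmorph1 -scalerAl mul1r scalerA.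
have residues c : alpha12 = cyclo_elt zeta c -> satisfies_1_2 c.
  move=> def_c; rewrite def_c in norm12.
  (* Powers of [g] are nonzero residues, so every [S m] equals [S0 - p1 * p2], which gives both
     claims. *)
  have SE m :=
    residue_sum_norm pr_l zP genL isoG (nz_g e) ord_beta norm12 (nz_g m).
  by split=> [|m _]; rewrite !SE // subKr.
have alphaE := comp_coefE pr_l zP genL isoG f a b nz_dl.
have alpha0E : a 0 = 0 -> alpha12 = cyclo_elt zeta (comp_coef0 f dl a b).
  move=> a0; rewrite [LHS]alphaE -(cyclo_elt_shift pr_l zP _ (comp_coef f dl a b 0)).
  by apply: eq_bigr => k _; rewrite comp_coef0E.
split=> [|a0 _ c]; first by split; [exact: alphaE | exact/residues/alphaE].
split; last exact/residues/alpha0E.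
rewrite alpha0E // /cyclo_elt (bigD1 0) //=.
by rewrite /comp_coef0 eqxx scale0r add0r.
Qed.
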